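(* Every natural number $m\ge 1$ can be written as a finite sum of distinct unit fractions \[ m=\sum_{i=1}^{k}\frac{1}{n_i},\qquad n_1<n_2<\cdots<n_k, \] in which each denominator $n_i$ is a product of two distinct primes. *)

(* Defs.v *)
From mathcomp Require Import all_boot all_order all_algebra.

Set Implicit Arguments.
Unset Strict Implicit.
Unset Printing Implicit Defensive.

Definition product_of_two_distinct_primes (n : nat) : Prop :=
  exists p q : nat, [/\ prime p, prime q, p != q & n = p * q].

(* Main.v *)
Require Import Defs.
From Stdlib Require Import NArith.
From mathcomp Require Import all_boot all_order all_algebra ring lra zify.
Set Implicit Arguments.
Unset Strict Implicit.
Unset Printing Implicit Defensive.

(** Let x be a rational whose denominator is a product of distinct primes, the
largest being p.  If the residues of 1/q mod p (q < p prime) have enough subset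
sums, one can subtract from x a sum of terms 1/(p q) so that p disappears from
the denominator.  Using either a subset or the complement of a subset for the
complementary residue, the subtracted amount can be taken at most, or at least,
half of T_p = (1/p) sum_(q < p) 1/q.  Hence if every admissible x in an interval
[L, U] of width at least T_p is a sum of distinct 1/(p' q') with p', q' < p, then
the same holds with p', q' <= p in the interval shifted by T_p / 2.  The shifted
intervals sweep out a half-line since sum T_p diverges.

The process starts from the denominator 210, with the six 1/(p q), p, q <= 7,
supplemented by four gadgets such as 1/62 + 1/93 + 1/155 = 7/210; the primes 31,
41, 59, 71 used by the gadgets are excluded from the induction.

That all residues mod p are subset sums is verified by computation for p < 2304.
For larger p it follows from Olson's argument based on the Cauchy-Davenport
theorem, which needs only a multiple of sqrt p elements, together with
Chebyshev's lower bound for the number of primes. *)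

(** * Chebyshev's lower bound *)

(** Passing from [n] to [n + 1] multiplies [n * 'C(2 * n, n)] by [2 * (2 * n + 1) / n], which is at
    least 4. *)
Lemma central_bin_lb (n : nat) : 0 < n -> 4 ^ n <= 2 * n * 'C(2 * n, n).
Proof.
case: n => // n _; elim: n => [|n IH]; first by [].
have E : n.+2 * 'C(2 * n.+2, n.+2) = 2 * (2 * n.+1).+1 * 'C(2 * n.+1, n.+1).
  have -> : 2 * n.+2 = (2 * n.+1).+2 by lia.
  rewrite binS -[in 'C(_, n.+1)](@bin_sub _ n.+1); last by lia.
  have -> : (2 * n.+1).+1 - n.+1 = n.+2 by lia.
  by rewrite -[2 * _ * _]mulnA (mul_bin_diag _.+1) addnn -mul2n; lia.
rewrite expnS -mulnA E.
apply: leq_trans (leq_mul (leqnn 4) IH) _.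
by rewrite !mulnA leq_mul2r; apply/orP; right; lia.
Qed.

Lemma sum_leq_bound (L N : nat) : \sum_(1 <= k < N.+1) (k <= L) <= minn N L.
Proof.
elim: N => [|N IH]; first by rewrite big_geq.
rewrite big_nat_recr //=; case: (leqP N.+1 L) => H; lia.
Qed.

(** By Legendre's formula the exponent of [p] is the sum over [k] of the floor of [2n/p^k] minus
    twice the floor of [n/p^k]. Each term is 0 or 1, and it vanishes once [p^k] exceeds [2n]. *)
Lemma expn_logn_central_bin (p n : nat) : prime p -> 0 < n ->
  p ^ logn p 'C(2 * n, n) <= 2 * n.
Proof.
move=> p_pr n0; have p1 := prime_gt1 p_pr.
have n2 : 0 < 2 * n by lia.
have le_n : n <= 2 * n by lia.
have := congr1 (logn p) (bin_fact le_n).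
have -> : 2 * n - n = n by lia.
rewrite !lognM ?muln_gt0 ?fact_gt0 ?bin_gt0 // !logn_fact // => E.
have leL : logn p 'C(2 * n, n) <= trunc_log p (2 * n).
  set S := \sum_(1 <= k < n.+1) _ in E; rewrite -(leq_add2r (S + S)) E /S {E S}.
  (* The sum for [n!] is extended to the range of the sum for [(2n)!], so that the two compare term
     by term; the added terms have [p^k > n] and are zero. *)
  have -> : \sum_(1 <= k < n.+1) n %/ p ^ k = \sum_(1 <= k < (2 * n).+1) n %/ p ^ k.
    rewrite [RHS](big_cat_nat (n := n.+1)) //=.
    rewrite [X in _ = _ + X]big_nat_cond [X in _ = _ + X]big1 ?addn0 // => k.
    rewrite andbT => /andP[nk _]; apply: divn_small.
    exact: leq_trans nk (ltnW (ltn_expl _ p1)).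
  apply: leq_trans (_ : \sum_(1 <= k < (2 * n).+1)
      ((k <= trunc_log p (2 * n)) + (n %/ p ^ k + n %/ p ^ k)) <= _).
    apply: leq_sum => k _.
    have [kL|Lk] := leqP k (trunc_log p (2 * n)).
      have pk0 : 0 < p ^ k by rewrite expn_gt0 ltnW.
      rewrite -ltnS ltn_divLR // add1n.
      have := ltn_ceil n pk0; set q := n %/ _; nia.
    rewrite divn_small //; apply: leq_trans (trunc_log_ltn _ p1) _.
    by rewrite leq_exp2l.
  rewrite !big_split /= leq_add2r.
  by apply: leq_trans (sum_leq_bound _ _) (geq_minr _ _).
by apply: leq_trans (trunc_logP p1 n2); rewrite leq_exp2l.
Qed.

Lemma central_bin_ub (n : nat) : 0 < n ->
  'C(2 * n, n) <= (2 * n) ^ count prime (iota 0 (2 * n).+1).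
Proof.
move=> n0; have C0 : 0 < 'C(2 * n, n) by rewrite bin_gt0; lia.
rewrite {1}(prod_prime_decomp C0) prime_decompE big_map /=.
apply: leq_trans (_ : \prod_(p <- primes 'C(2 * n, n)) (2 * n) <= _).
  rewrite big_seq [leqRHS]big_seq; apply: leq_prod => p.
  by rewrite mem_primes => /andP[p_pr _]; apply: expn_logn_central_bin.
rewrite big_const_seq count_predT iter_muln_1. rewrite leq_exp2l; last by lia.
rewrite -size_filter; apply: uniq_leq_size (primes_uniq _) _ => p pC.
rewrite mem_filter mem_iota /= ltnS.
have p_pr : prime p by move: pC; rewrite mem_primes => /andP[].
rewrite p_pr (prime_gt0 p_pr) /=; apply: leq_trans (expn_logn_central_bin p_pr n0).
by rewrite -{1}(expn1 p) leq_exp2l ?prime_gt1 // logn_gt0.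
Qed.

(** Take [2n = 2^j] in the two bounds for the central binomial coefficient and compare exponents of
    2. *)
Lemma prime_count_pow2 (j : nat) : 1 < j ->
  2 ^ j <= j * (count prime (iota 0 (2 ^ j))).+1.
Proof.
case: j => // j j1.
have n0 : 0 < 2 ^ j by rewrite expn_gt0.
have := leq_trans (central_bin_lb n0) (leq_mul (leqnn _) (central_bin_ub n0)).
rewrite -expnS -(expnM 2 2) -expnS -[in iota _ _]addn1 iotaD count_cat /= add0n.
(* The upper bound counts primes up to [2n] inclusive; the endpoint is a proper power of 2 and drops
   out. *)
have -> : prime (2 ^ j.+1) = false.
  apply/negP => /primeP[_ /(_ 2)]; rewrite dvdn_exp // => /(_ isT)/orP[/eqP//|/eqP].
  by rewrite expnS; case: (j) j1 n0 => // i _; rewrite expnS; lia.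
by rewrite !addn0 -expnM leq_exp2l // mulnC.
Qed.

Import GRing.Theory.
Local Open Scope ring_scope.

(** * Subset sums modulo a prime *)

Definition sumset (V : finZmodType) (A B : {set V}) : {set V} :=
  [set a + b | a in A, b in B].

Lemma card_translate (V : finZmodType) (A : {set V}) (e : V) :
  #|[set x + e | x in A]| = #|A|.
Proof. by apply: card_imset; apply: addIr. Qed.

Lemma mem_translate (V : finZmodType) (A : {set V}) (e x : V) :
  (x \in [set y + e | y in A]) = (x - e \in A).
Proof.
apply/imsetP/idP => [[y yA ->]|xA]; first by rewrite addrK.
by exists (x - e) => //; rewrite subrK.
Qed.

Lemma Fp_orbit_full (p : nat) (p_pr : prime p) (A : {set 'F_p}) (a d : 'F_p) :
  a \in A -> d != 0 -> {in A, forall x, x + d \in A} -> A = setT.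
Proof.
move=> aA d0 Ad.
have Amul k : a + d *+ k \in A.
  by elim: k => [|k IH]; rewrite ?addr0 // mulrSr addrA Ad.
apply/setP=> z; rewrite inE.
have -> : z = a + d *+ (val ((z - a) / d)); last exact: Amul.
by rewrite -mulr_natr natr_Zp mulrC divfK // addrC subrK.
Qed.

(** Induction on the size of [B] by Dyson's e-transform. If every translate of [B] by a difference
    [x - y] stays inside [A], then either [B] is a singleton or [A] is stable under a nonzero shift,
    hence is everything. *)
Lemma cauchy_davenport (p : nat) (p_pr : prime p) (A B : {set 'F_p}) :
  A != set0 -> B != set0 ->
  (minn p (#|A| + #|B|).-1 <= #|sumset A B|)%N.
Proof.
have [n] := ubnP #|B|; elim: n A B => // n IH A B; rewrite ltnS => leBn.
move=> /set0Pn[a aA] /set0Pn[b bB].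
have [/forall_inP stable|/forall_inPn[a1 a1A /forall_inPn[b1 b1B]]] :=
  boolP [forall x in A, forall y in B, [set z + (x - y) | z in B] \subset A].
- have [/card_le1_eqP B1|] := leqP #|B| 1.
    have -> : B = [set b].
      apply/setP=> y; rewrite inE; apply/idP/eqP => [yB|->//].
      exact: B1.
    rewrite cards1 addn1 /= geq_min; apply/orP; right.
    rewrite -(card_translate A b) subset_leq_card //.
    by apply/subsetP=> _ /imsetP[x xA ->]; apply/imset2P; exists x b; rewrite ?inE.
  move=> /card_gt1P[b1 [b2 [b1B b2B neb]]].
  have AT : A = setT.
    apply: (@Fp_orbit_full p p_pr A a (b2 - b1) aA); first by rewrite subr_eq0 eq_sym.
    move=> x xA; have /forall_inP/(_ b1 b1B)/subsetP := stable x xA; apply.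
    by rewrite mem_translate; have -> : x + (b2 - b1) - (x - b1) = b2 by ring.
  have -> : sumset A B = setT.
    apply/setP=> z; rewrite inE; apply/imset2P; exists (z - b) b => //.
      by rewrite AT inE.
    by rewrite subrK.
  by rewrite cardsT card_Fp // geq_minl.
- set e := a1 - b1 => nsub.
  set Be := [set z + e | z in B] in nsub.
  (* The e-transform preserves the total size, does not enlarge the sumset, keeps both sets nonempty
     and makes [B] strictly smaller. *)
  pose A' := A :|: Be; pose B' := [set y in B | y + e \in A].
  have B'E : [set z + e | z in B'] = A :&: Be.
    apply/setP=> z; rewrite mem_translate !inE subrK mem_translate.
    by rewrite andbC.
  have card' : (#|A'| + #|B'| = #|A| + #|B|)%N.
    by rewrite -(card_translate B' e) B'E -(card_translate B e) cardsUI.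
  have B'0 : B' != set0.
    by apply/set0Pn; exists b1; rewrite inE b1B /e addrC subrK.
  have A'0 : A' != set0 by apply/set0Pn; exists a; rewrite inE aA.
  have ltB' : (#|B'| < #|B|)%N.
    rewrite -(card_translate B' e) B'E -(card_translate B e).
    apply: proper_card; rewrite properE subsetIr /=.
    by apply: contra nsub => /subset_trans; apply; apply: subsetIl.
  have /IH/(_ A'0 B'0) := leq_trans ltB' leBn.
  rewrite card' => /leq_trans; apply; apply: subset_leq_card.
  apply/subsetP=> _ /imset2P[x y xA' + ->]; rewrite inE => /andP[yB yeA].
  move: xA'; rewrite inE mem_translate => /orP[xA|xB].
    by apply/imset2P; exists x y.
  apply/imset2P; exists (y + e) (x - e) => //.
  by ring.
Qed.

(** * Olson's growth argument for sets of subset sums *)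

Definition outflow (V : finZmodType) (X : {set V}) (g : V) : nat :=
  #|[set x in X | x + g \notin X]|.

Lemma outflow0 (V : finZmodType) (X : {set V}) : outflow X 0 = 0%N.
Proof.
by apply: eq_card0 => x; rewrite !inE addr0 andbN.
Qed.

Lemma outflowD (V : finZmodType) (X : {set V}) (g h : V) :
  (outflow X (g + h)%R <= outflow X g + outflow X h)%N.
Proof.
rewrite /outflow -(card_translate [set x in X | x + h \notin X] (- g)).
apply: leq_trans (leq_card_setU _ _); apply: subset_leq_card.
apply/subsetP=> x; rewrite !inE mem_translate opprK !inE => /andP[xX xgh].
by rewrite xX -addrA xgh andbT /= orNb.
Qed.

(** If [X] consists of subset sums, allowing [g] as a further summand gains exactly [outflow X g]
    new ones. *)
Lemma card_translateU (V : finZmodType) (X : {set V}) (g : V) :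
  #|X :|: [set x + g | x in X]| = (#|X| + outflow X g)%N.
Proof.
rewrite -(cardsID X (_ :|: _)) setIUl setIid.
rewrite (setUidPl (subsetIr _ _)); congr addn.
rewrite setDUl setDv set0U /outflow -(card_translate [set x in X | _] g).
apply: eq_card => x; rewrite !(inE, mem_translate) subrK andbC.
by rewrite andbC.
Qed.

(** Double counting: for a fixed [x] in [X], at most [#|X|] elements [g] keep [x + g] inside [X];
    all the others contribute to the outflow. *)
Lemma sum_outflow (V : finZmodType) (X H : {set V}) :
  (#|X| * #|H| <= #|X| ^ 2 + \sum_(g in H) outflow X g)%N.
Proof.
have -> : (\sum_(g in H) outflow X g = \sum_(x in X) #|[set g in H | (x + g)%R \notin X]|)%N.
  under eq_bigr do rewrite /outflow -sum1_card.
  under [RHS]eq_bigr do rewrite -sum1_card.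
  rewrite (exchange_big_dep (mem X)) /=; last by move=> g x _; rewrite inE => /andP[].
  by apply: eq_bigr => x xX; apply: eq_bigl => g; rewrite !inE xX.
rewrite expnS expn1 -!sum_nat_const -big_split /=.
apply: leq_sum => x xX.
rewrite -(cardsID [set g | x + g \in X] H); apply: leq_add; last first.
  by apply: subset_leq_card; apply/subsetP=> g; rewrite !inE andbC.
rewrite -(card_imset (H :&: _) (addrI x)); apply: subset_leq_card.
by apply/subsetP=> _ /imsetP[g + ->]; rewrite !inE => /andP[].
Qed.

Lemma iter_sumset_card (p : nat) (p_pr : prime p) (R : {set 'F_p}) (j : nat) :
  0 \notin R ->
  (minn p (j * #|R|).+1 <= #|iter j (fun H => sumset H (0%R |: R)) [set 0%R]|)%N.
Proof.
move=> R0; elim: j => [|j IH] /=; first by rewrite cards1 geq_minr.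
set H := iter j _ _ in IH *.
have H0 : H != set0.
  by rewrite -card_gt0; apply: leq_trans IH; rewrite leq_min prime_gt0.
have R0' : 0 |: R != set0 by apply/set0Pn; exists 0; rewrite setU11.
apply: leq_trans (cauchy_davenport p_pr H0 R0').
rewrite cardsU1 R0 add1n addnS /= leq_min geq_minl /=.
have [leHp|ltpH] := leqP (j * #|R|).+1 p.
  move/minn_idPr: (leHp) IH => -> IH.
  by rewrite geq_min mulSn [(#|R| + _)%N]addnC ltn_add2r IH orbT.
move/minn_idPl: (ltnW ltpH) IH => -> IH.
by rewrite geq_min (leq_trans IH) ?leq_addr.
Qed.

Lemma outflow_iter_sumset (V : finZmodType) (X R : {set V}) (t j : nat) :
  {in R, forall a, outflow X a <= t}%N ->
  {in iter j (fun H => sumset H (0%R |: R)) [set 0%R],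
    forall g, outflow X g <= j * t}%N.
Proof.
move=> Rt; elim: j => [|j IH] g /=; first by rewrite inE => /eqP->; rewrite outflow0.
case/imset2P=> h a /IH ht aR ->; apply: leq_trans (outflowD _ _ _) _.
rewrite mulSn addnC leq_add //.
by move: aR; rewrite inE => /orP[/set1P->|/Rt//]; rewrite outflow0.
Qed.

(* Olson's averaging: outflow is subadditive, so if it were small on [R] it
   would be small on the [j]-fold sumset, contradicting its large mean there. *)
Lemma exists_outflow_gt (p : nat) (p_pr : prime p) (X R : {set 'F_p}) (t j : nat) :
  0 \notin R -> (2 * #|X| <= p)%N -> (2 * #|X| <= (j * #|R|).+1)%N ->
  (2 * j * t < #|X|)%N -> exists2 a, a \in R & (t < outflow X a)%N.
Proof.
move=> R0 Xp Xj tX; apply/exists_inP; apply: contraLR tX.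
rewrite negb_exists_in -leqNgt => /forall_inP Rt.
have {}Rt : {in R, forall a, outflow X a <= t}%N by move=> a /Rt; rewrite -leqNgt.
have Hge := iter_sumset_card p_pr j R0.
have Ht := outflow_iter_sumset (j := j) Rt.
set H := iter j _ _ in Hge Ht.
have {}Hge : (2 * #|X| <= #|H|)%N by apply: leq_trans Hge; rewrite leq_min Xp.
have := sum_outflow X H.
have : (\sum_(g in H) outflow X g <= #|H| * (j * t))%N.
  by rewrite -sum_nat_const; apply: leq_sum => g /Ht.
have [->|X0] := posnP #|X|; first by [].
move: (#|X|) (#|H|) (\sum_(_ in _) _)%N X0 Hge => x h s; nia.
Qed.

(** The size guaranteed after one more summand when [r] candidates remain: [exists_outflow_gt] is
    applied with [j = (2 * x) %/ r + 1], and the final successor reflects its strict inequality. *)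
Definition growth (r x : nat) : nat :=
  (x + ((x.-1 %/ (2 * ((2 * x) %/ r).+1)).+1))%N.

Lemma exists_card_subset (T : finType) (A : {set T}) (n : nat) :
  (n <= #|A|)%N -> exists2 B : {set T}, B \subset A & #|B| = n.
Proof.
move=> nA; exists [set x in take n (enum A)].
  by apply/subsetP=> x; rewrite inE => /mem_take; rewrite mem_enum.
rewrite cardsE; have /card_uniqP -> : uniq (take n (enum A)) by rewrite take_uniq ?enum_uniq.
by rewrite size_takel // -cardE.
Qed.

Lemma subset_sums_growth (p : nat) (p_pr : prime p) (r k : nat) (A : {set 'F_p}) :
  0 \notin A -> (0 < r)%N -> (r + k <= #|A|)%N ->
  exists U X : {set 'F_p},
    [/\ U \subset A, (#|U| <= k)%N,
        (#|X| == iter k (growth r) 1%N) || (p < 2 * #|X|)%N &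
        {in X, forall x, exists2 S : {set 'F_p}, S \subset U & \sum_(a in S) a = x}].
Proof.
move=> A0 r0; elim: k => [|k IH] kA.
  exists set0, [set 0]; rewrite sub0set !cards0 cards1 eqxx; split=> // x.
  by rewrite inE => /eqP->; exists set0; rewrite ?big_set0 ?sub0set.
have [|U [X [UA Uk Xk XU]]] := IH; first by lia.
have [Xbig|Xsmall] := ltnP p (2 * #|X|).
  by exists U, X; rewrite Xbig orbT; split=> //; apply: leq_trans Uk _.
have {}Xk : #|X| = iter k (growth r) 1%N.
  by case/orP: Xk => [/eqP//|]; rewrite ltnNge Xsmall.
have X0 : (0 < #|X|)%N by rewrite Xk; case: (k) => [|?] //=; rewrite /growth addnS.
have AU : (r <= #|A :\: U|)%N by rewrite cardsDS //; lia.
have AU0 : 0 \notin A :\: U by rewrite inE negb_and A0 orbT.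
have Xj : (2 * #|X| <= ((2 * #|X| %/ r).+1 * #|A :\: U|).+1)%N.
  apply: leq_trans (leqnSn _); apply: leq_trans (ltnW (ltn_ceil (2 * #|X|) r0)) _.
  by rewrite leq_mul2l AU.
have tX : (2 * (2 * #|X| %/ r).+1 * (#|X|.-1 %/ (2 * (2 * #|X| %/ r).+1)) < #|X|)%N.
  by rewrite mulnC (leq_ltn_trans (leq_divM _ _)) // prednK.
have [a] := exists_outflow_gt p_pr AU0 Xsmall Xj tX.
rewrite inE => /andP[aU aA] Xa.
have /exists_card_subset[Y YX cY] : (growth r #|X| <= #|X :|: [set (x + a)%R | x in X]|)%N.
  by rewrite card_translateU leq_add2l.
exists (a |: U), Y; rewrite cY Xk /= eqxx; split=> //.
- by rewrite subUset sub1set aA.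
- by rewrite cardsU1 aU.
- move=> y /(subsetP YX); rewrite !inE mem_translate => /orP[]/XU[S SU Sy].
    by exists S => //; apply: subset_trans SU (subsetU1 _ _).
  exists (a |: S); first by rewrite setUS.
  rewrite big_setU1 ?Sy /=; first by rewrite addrC subrK.
  by apply: contra aU; apply: (subsetP SU).
Qed.

(** Two disjoint batches of at most [k] summands each produce more than [p / 2] sums, so by the
    pigeonhole principle [X] meets [z - Y]. *)
Theorem subset_sums_cover (p : nat) (p_pr : prime p) (r k : nat) (A : {set 'F_p}) :
  0 \notin A -> (0 < r)%N -> (r + 2 * k <= #|A|)%N ->
  (p < 2 * iter k (growth r) 1)%N ->
  forall z : 'F_p, exists S : {set 'F_p},
    [/\ S \subset A, (#|S| <= 2 * k)%N & \sum_(a in S) a = z].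
Proof.
move=> A0 r0 Ak gp z.
have rk : (r + k <= #|A|)%N by lia.
have [U [X [UA Uk Xk XU]]] := subset_sums_growth p_pr A0 r0 rk.
have A0' : 0 \notin A :\: U by rewrite inE negb_and A0 orbT.
have Ak' : (r + k <= #|A :\: U|)%N by rewrite cardsDS //; lia.
have [W [Y [WA Wk Yk YW]]] := subset_sums_growth p_pr A0' r0 Ak'.
have {}Xk : (p < 2 * #|X|)%N by case/orP: Xk => [/eqP->|].
have {}Yk : (p < 2 * #|Y|)%N by case/orP: Yk => [/eqP->|].
have : ~~ [disjoint X & [set z - y | y in Y]].
  apply/negP; rewrite -leq_card_setU => /eqP E.
  have := max_card (X :|: [set z - y | y in Y]).
  rewrite E card_Fp // card_imset; last by move=> u v /addrI/oppr_inj.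
  rewrite leqNgt => /negP; apply; rewrite -(ltn_pmul2l (isT : 0 < 2)%N) mulnDr.
  by apply: leq_trans (leq_add Xk Yk); lia.
case/pred0Pn=> x /andP[/XU[S SU Sx] /imsetP[y /YW[S' SW Sy] Exy]].
have dSS' : [disjoint S & S'].
  rewrite disjoint_sym; apply: disjointWl SW _; rewrite disjoints_subset.
  apply/subsetP=> u /(subsetP WA); rewrite !inE => /andP[uU _].
  by apply: contra uU => /(subsetP SU).
exists (S :|: S'); split.
- by rewrite subUset (subset_trans SU) // (subset_trans SW) // (subset_trans WA) // subsetDl.
- apply: leq_trans (leq_card_setU _ _) _; rewrite mul2n -addnn.
  by apply: leq_add; [apply: leq_trans Uk | apply: leq_trans Wk]; apply: subset_leq_card.
- rewrite (eq_bigl [predU S & S']) => [|u]; last by rewrite !inE.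
  by rewrite bigU //= Sx Sy Exy subrK.
Qed.

Lemma growth_ge1 (r n : nat) : (n < iter n (growth r) 1)%N.
Proof. by elim: n => //= n IH; rewrite /growth addnS ltnS (leq_trans IH) // leq_addr. Qed.

(** The first [6 * s] steps bring the size to at least [6 * s], gaining at least 1 each. From then
    on [j * 6s <= 2x + 6s <= 3x], so every step gains at least [x / (2j) >= s]. *)
Lemma growth_linear (s i : nat) :
  (0 < s)%N -> (6 * s + i * s <= iter (i + 6 * s) (growth (6 * s)) 1)%N.
Proof.
move=> s0; elim: i => [|i IH]; first by rewrite mul0n !addn0 ltnW ?growth_ge1.
rewrite /=; set x := iter _ _ _ in IH *.
rewrite mulSn addnCA addnC /growth; apply: leq_add => //.
have x0 : (6 * s <= x)%N by apply: leq_trans IH; rewrite leq_addr.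
set j := (2 * x %/ (6 * s)).+1.
have jx : (j * (6 * s) <= 3 * x)%N.
  have := leq_divM (2 * x) (6 * s); rewrite /j mulSn; lia.
have j0 : (0 < 2 * j)%N by [].
have := ltn_ceil x.-1 j0.
set q := (_ %/ _)%N; nia.
Qed.

Import Order.TTheory Num.Theory.

(** * Sums of reciprocals of primes modulo a large prime *)

Definition gadget_primes : seq nat := [:: 31; 41; 59; 71]%N.
Definition usable (q : nat) : bool := prime q && (q \notin gadget_primes).
Definition uprimes (a b : nat) : seq nat := [seq q <- index_iota a b | usable q].
Definition recip (s : seq nat) : rat := \sum_(q <- s) q%:R^-1.

(** The cap [e] on the rational sum of reciprocals controls how far one step moves the ends of the
    attained interval. *)
Definition covers (p : nat) (Q : seq nat) (e : rat) : Prop :=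
  forall r : 'F_p, exists S : seq nat,
    [/\ uniq S, {subset S <= Q}, \sum_(q <- S) q%:R^-1 = r & recip S <= e].

Lemma mem_uprimes (a b q : nat) : (q \in uprimes a b) = usable q && (a <= q < b)%N.
Proof. by rewrite mem_filter mem_index_iota. Qed.

Lemma uprimes_uniq (a b : nat) : uniq (uprimes a b).
Proof. by rewrite filter_uniq ?iota_uniq. Qed.

Lemma usable_prime (q : nat) : usable q -> prime q.
Proof. by case/andP. Qed.

Lemma recip_ge0 (s : seq nat) : 0 <= recip s.
Proof. by apply: sumr_ge0 => q _; rewrite invr_ge0 ler0n. Qed.

Lemma recip_subset (s t : seq nat) : uniq s -> {subset s <= t} -> recip s <= recip t.
Proof.
elim: s t => [|x s IH] t /=; first by rewrite /recip big_nil => *; apply: recip_ge0.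
move=> /andP[xs us] sub; have xt : x \in t by apply: sub; rewrite inE eqxx.
rewrite /recip big_cons (perm_big _ (perm_to_rem xt)) big_cons lerD2l.
apply: IH => // y ys; have : y \in t by apply: sub; rewrite inE ys orbT.
rewrite (perm_mem (perm_to_rem xt)) inE => /orP[/eqP yx|//].
by rewrite -yx ys in xs.
Qed.

Lemma Fp_nat_inj (p a b : nat) : prime p -> (a < p)%N -> (b < p)%N ->
  a%:R = b%:R :> 'F_p -> a = b.
Proof.
move=> p_pr ap bp /(congr1 val); rewrite /= !val_Fp_nat //.
by rewrite !modn_small.
Qed.

Lemma Fp_nat_eq0 (p a : nat) : prime p -> (a%:R == 0 :> 'F_p) = (p %| a)%N.
Proof. by move=> p_pr; rewrite -(dvdn_pcharf (pchar_Fp p_pr)). Qed.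

Lemma recip_const_bound (s : seq nat) (y : nat) : (0 < y)%N ->
  {in s, forall q, y <= q}%N -> recip s <= (size s)%:R / y%:R.
Proof.
move=> y0; rewrite /recip; elim: s => [|q s IH] sy; first by rewrite big_nil mul0r.
rewrite big_cons /= -natr1 mulrDl mul1r addrC lerD ?IH //.
  by move=> z zs; apply: sy; rewrite inE zs orbT.
have yq := sy q (mem_head _ _).
by rewrite lef_pV2 ?posrE ?ltr0n ?ler_nat // (leq_trans y0).
Qed.

(** At most [2 * k] primes are used, all at least [y], so their reciprocals sum to at most [2k / y];
    the condition [12 * k <= 5 * y] makes this at most 5/6. Since 5/6 = 1/2 + 1/3 is the mass of the
    omitted primes 2 and 3, the chosen set will carry at most half of the total mass. *)
Lemma covers_of_pool (p P y r k : nat) : prime p -> (P <= p)%N -> (5 <= y)%N ->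
  (0 < r)%N -> (r + 2 * k <= size (uprimes y P))%N -> (12 * k <= 5 * y)%N ->
  (p < 2 * iter k (growth r) 1)%N -> covers p (uprimes 5 p) (5 / 6).
Proof.
move=> p_pr Pp y5 r0 rk ky pk z.
pose f (q : nat) : 'F_p := (q%:R)^-1.
set l := uprimes y P in rk.
have lP q : q \in l -> [&& usable q, y <= q & q < p]%N.
  by rewrite mem_uprimes => /and3P[-> -> /leq_trans->].
have f_inj : {in l &, injective f}.
  move=> a b /lP/and3P[_ _ ap] /lP/and3P[_ _ bp] /invr_inj.
  exact: Fp_nat_inj.
have ul : uniq l := uprimes_uniq y P.
have ufl : uniq (map f l) by rewrite map_inj_in_uniq.
pose A := [set x in map f l].
have cA : #|A| = size l.
  by rewrite cardsE (card_uniqP ufl) size_map.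
have A0 : 0 \notin A.
  rewrite inE; apply/mapP=> -[q /lP/and3P[/usable_prime q_pr _ qp]] /esym/eqP.
  rewrite invr_eq0 Fp_nat_eq0 // dvdn_prime2 // => /eqP pq.
  by rewrite pq ltnn in qp.
rewrite -cA in rk.
have [S [SA Sk Sz]] := subset_sums_cover p_pr A0 r0 rk pk z.
pose s := [seq q <- l | f q \in S].
have us : uniq s by rewrite filter_uniq.
have sl : {subset s <= l} by move=> q; rewrite mem_filter => /andP[].
have ufs : uniq (map f s).
  by rewrite map_inj_in_uniq // => a b /sl al /sl bl; apply: f_inj.
have mfs : map f s =i S.
  move=> x; apply/mapP/idP => [[q + ->]|xS]; first by rewrite mem_filter => /andP[].
  have : x \in A := subsetP SA x xS.
  by rewrite inE => /mapP[q ql xq]; exists q; rewrite // mem_filter -xq xS.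
exists s; split=> //.
- move=> q /sl /lP/and3P[uq yq qp]; rewrite mem_uprimes uq qp andbT /=.
  exact: leq_trans yq.
- rewrite -(big_map f xpredT id) -Sz -big_enum /=; apply: perm_big.
  by apply: uniq_perm; rewrite ?enum_uniq // => x; rewrite mem_enum mfs.
- have y0 : (0 < y)%N by lia.
  apply: le_trans (recip_const_bound y0 _) _; first by move=> q /sl/lP/and3P[].
  have -> : size s = #|S|.
    by rewrite -(size_map f) -(card_uniqP ufs); apply: eq_card.
  rewrite ler_pdivrMr ?ltr0n //.
  have : (6 * #|S| <= 5 * y)%N by move: #|S| Sk => c; lia.
  rewrite -(ler_nat rat) !natrM; lra.
Qed.

Lemma size_uprimes_ge (y P : nat) :
  (count prime (iota 0 P) <= size (uprimes y P) + y + 4)%N.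
Proof.
rewrite -size_filter -addnA -[y in (y + 4)%N](size_iota 0) -[4%N]/(size gadget_primes).
rewrite -!size_cat; apply: uniq_leq_size; first by rewrite filter_uniq ?iota_uniq.
move=> q; rewrite mem_filter mem_iota !mem_cat mem_uprimes mem_iota /= add0n.
case/andP=> q_pr qP; rewrite /usable q_pr qP andbT /=.
by case: (q \in gadget_primes) => /=; rewrite ?orbT // ?add0n; case: leqP; rewrite ?orbT.
Qed.

Lemma size_uprimes_pow2 (y j : nat) : (1 < j)%N ->
  (2 ^ j <= j * (size (uprimes y (2 ^ j)) + y + 5))%N.
Proof.
move=> j1; apply: leq_trans (prime_count_pow2 j1) _.
rewrite leq_mul2l; apply/orP; right.
by have := size_uprimes_ge y (2 ^ j); lia.
Qed.

(** With [s = 2 ^ i], the factors 56 and 76 are the coefficients of [s] in [r + 2k + y] for the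
    parameters [(r, k, y)] equal to [(6s, 10s, 30s)] and [(6s, 14s, 42s)]. *)
Lemma pow2_superlinear (i : nat) : (8 <= i)%N ->
  (((2 * i + 2) * (56 * 2 ^ i + 5) <= 4 * (2 ^ i * 2 ^ i)) /\
   ((2 * i + 3) * (76 * 2 ^ i + 5) <= 8 * (2 ^ i * 2 ^ i)))%N.
Proof.
move=> /subnK <-; elim: (i - 8)%N => [|n]; first by rewrite add0n; split; vm_compute.
rewrite addSn expnS; move: (n + 8)%N (leq_addl n 8) => m m8.
have : (0 < 2 ^ m)%N by rewrite expn_gt0.
move: (2 ^ m)%N => a a0 [H1 H2]; split; nia.
Qed.

(** Here [s] is of order [sqrt p], so gains of [s] over [4s] or [8s] steps, according to the parity
    of [j], push the number of sums past [p / 2]. Chebyshev's bound below [2 ^ j] supplies the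
    pool. *)
Lemma covers_ge_pow18 (p : nat) : prime p -> (2 ^ 18 <= p)%N ->
  covers p (uprimes 5 p) (5 / 6).
Proof.
move=> p_pr p18; pose j := trunc_log 2 p.
have p0 : (0 < p)%N by apply: prime_gt0.
have jp : (2 ^ j <= p)%N by apply: trunc_logP.
have pj : (p < 2 ^ j.+1)%N by apply: trunc_log_ltn.
have j18 : (18 <= j)%N by apply: trunc_log_max.
pose i := ((j - 2) %/ 2)%N; pose s := (2 ^ i)%N.
have i8 : (8 <= i)%N by rewrite /i; lia.
have s0 : (256 <= s)%N by rewrite /s (@leq_pexp2l 2 8).
have [jE|jE] : j = (2 * i + 2)%N \/ j = (2 * i + 3)%N by rewrite /i; lia.
- have E : (2 ^ j = 4 * s * s)%N by rewrite jE expnD mulnC mul2n -addnn expnD mulnA.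
  apply: (@covers_of_pool p (2 ^ j) (3 * (4 * s + 6 * s)) (6 * s) (4 * s + 6 * s)) => //; try lia.
    have := @size_uprimes_pow2 (3 * (4 * s + 6 * s)) j (leq_trans (isT : 1 < 18)%N j18).
    have [+ _] := pow2_superlinear i8; rewrite -/s -jE mulnA -E => H1 H2.
    move: (leq_trans H1 H2); rewrite leq_pmul2l; lia.
  have := @growth_linear s (4 * s) (leq_trans (isT : 0 < 256)%N s0).
  rewrite expnS E in pj; lia.
- have E : (2 ^ j = 8 * s * s)%N by rewrite jE expnD mulnC mul2n -addnn expnD mulnA.
  apply: (@covers_of_pool p (2 ^ j) (3 * (8 * s + 6 * s)) (6 * s) (8 * s + 6 * s)) => //; try lia.
    have := @size_uprimes_pow2 (3 * (8 * s + 6 * s)) j (leq_trans (isT : 1 < 18)%N j18).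
    have [_ +] := pow2_superlinear i8; rewrite -/s -jE mulnA -E => H1 H2.
    move: (leq_trans H1 H2); rewrite leq_pmul2l; lia.
  have := @growth_linear s (8 * s) (leq_trans (isT : 0 < 256)%N s0).
  rewrite expnS E in pj; lia.
Qed.

(** * Computed subset sums modulo small primes *)

(** A set of residues is stored as a bit mask; adjoining a summand [v] is a left shift by [v] whose
    bits from position [p] on are wrapped around. *)
Definition shift_mod (p v X : N) : N :=
  let Y := N.shiftl X v in N.lor X (N.lor (N.land Y (N.ones p)) (N.shiftr Y p)).

(** The extended Euclidean algorithm with fuel. [sums_fill] tests each inverse before using it, so
    soundness does not rest on this loop. *)
Fixpoint inv_loop (n : nat) (p r0 r1 t0 t1 : N) : N :=
  if n is n'.+1 then
    if N.eqb r1 0 then t0 else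
    let q := N.div r0 r1 in
    inv_loop n' p r1 (N.modulo r0 r1) t1 (N.modulo (t0 + (p - N.modulo (q * t1) p)) p)
  else t0.

Definition invN (p q : N) : N := inv_loop 30 p p q 0%num 1%num.
Arguments invN : simpl never.

Fixpoint sums_fill (p full X : N) (A : seq nat) : bool :=
  if N.eqb X full then true else
  if A is q :: A' then
    let qN := N.of_nat q in
    let v := invN p qN in
    if N.eqb (N.modulo (qN * v) p) 1 then sums_fill p full (shift_mod p v X) A'
    else sums_fill p full X A'
  else false.

Lemma shift_modP (p v X i : N) : N.testbit (shift_mod p v X) i ->
  [\/ N.testbit X i,
      exists2 l, N.testbit X l & i = (l + v)%num |
      exists2 l, N.testbit X l & (i + p)%num = (l + v)%num].
Proof.
have shl j : N.testbit (N.shiftl X v) j -> exists2 l, N.testbit X l & j = (l + v)%num.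
  move=> H; have [jv|vj] := N.lt_ge_cases j v.
    by rewrite N.shiftl_spec_low in H.
  exists (j - v)%num; last by rewrite N.sub_add.
  by rewrite N.shiftl_spec_high' in H.
rewrite /shift_mod !N.lor_spec N.land_spec N.shiftr_spec'.
case/orP=> [H|/orP[/andP[/shl H _]|/shl H]]; first by constructor 1.
- by constructor 2.
- by constructor 3.
Qed.

Definition sums_bits (p : nat) (X : N) (U : seq nat) : Prop :=
  forall i : N, N.testbit X i -> exists S : seq nat,
    [/\ uniq S, {subset S <= U} & \sum_(q <- S) q%:R^-1 = (nat_of_bin i)%:R :> 'F_p].

Lemma nat_of_binE (i : N) : nat_of_bin i = N.to_nat i.
Proof. lia. Qed.

Lemma nat_of_binD (i j : N) : nat_of_bin (i + j)%num = (nat_of_bin i + nat_of_bin j)%N.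
Proof. lia. Qed.

Lemma inv_of_modN (p q : nat) (v : N) : prime p ->
  N.modulo (N.of_nat q * v) (N.of_nat p) = 1%num ->
  (nat_of_bin v)%:R = q%:R^-1 :> 'F_p.
Proof.
move=> p_pr /(congr1 N.to_nat) E.
have p0 := prime_gt0 p_pr.
have Eq : (q * nat_of_bin v)%:R = 1 :> 'F_p.
  have p0N : N.of_nat p <> 0%num by lia.
  have := N.div_mod (N.of_nat q * v) (N.of_nat p) p0N.
  move=> /(congr1 N.to_nat); rewrite Nnat.N2Nat.inj_add !Nnat.N2Nat.inj_mul.
  rewrite E !Nnat.Nat2N.id => E'.
  have -> : (q * nat_of_bin v = p * N.to_nat (N.of_nat q * v / N.of_nat p) + 1)%N.
    by rewrite nat_of_binE.
  by rewrite natrD natrM pchar_Fp_0 // mul0r add0r.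
have q0 : q%:R != 0 :> 'F_p.
  by apply/eqP=> q0; move/eqP: Eq; rewrite natrM q0 mul0r eq_sym oner_eq0.
by apply: (mulfI q0); rewrite mulfV // -natrM.
Qed.

Lemma sums_fillP (p : nat) (full X : N) (A U : seq nat) : prime p ->
  uniq (A ++ U) -> sums_bits p X U -> sums_fill (N.of_nat p) full X A ->
  sums_bits p full (A ++ U).
Proof.
move=> p_pr; elim: A X U => [|q A IH] X U /=.
  by move=> _ XU; case: N.eqb_spec => // <-.
move=> /andP[qAU uAU] XU; case: N.eqb_spec => [<- _ i /XU[S [uS SU Si]]|_].
  by exists S; split=> // x /SU xU; rewrite inE mem_cat xU !orbT.
have mono Y B : {subset B <= A ++ (q :: U)} -> sums_bits p Y B -> sums_bits p Y (q :: A ++ U).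
  move=> sub H i /H[S [uS SB Si]]; exists S; split=> // x /SB/sub.
  by rewrite !(inE, mem_cat) => /or3P[->|->|->]; rewrite ?orbT.
set v := invN _ _.
case: N.eqb_spec => [/(inv_of_modN p_pr) vq|_ H]; last first.
  apply: mono (IH _ _ uAU XU H) => x; rewrite !mem_cat inE.
  by case/orP=> ->; rewrite ?orbT.
have uAqU : uniq (A ++ q :: U).
  by rewrite -cat1s uniq_catCA /= qAU.
apply: (fun H G => mono _ _ (fun x xA => xA) (IH _ _ uAqU H G)).
have add l : N.testbit X l -> exists S : seq nat, [/\ uniq S, {subset S <= q :: U} &
    \sum_(z <- S) z%:R^-1 = (nat_of_bin (l + v)%num)%:R :> 'F_p].
  move=> /XU[S [uS SU Sl]]; exists (q :: S); split=> /=.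
  - by rewrite uS andbT; apply: contra qAU => /SU; rewrite mem_cat => ->; rewrite orbT.
  - by move=> x; rewrite !inE => /orP[->//|/SU->]; rewrite orbT.
  - by rewrite big_cons Sl -vq nat_of_binD natrD addrC.
move=> i /shift_modP[/XU[S [uS SU Si]]|[l /add H ->]|[l /add[S [uS SU Sl]] E]] //.
  by exists S; split=> // x /SU xU; rewrite inE xU orbT.
exists S; split=> //; rewrite Sl -E nat_of_binD natrD.
have -> : nat_of_bin (N.of_nat p) = p by lia.
by rewrite pchar_Fp_0 // addr0.
Qed.

Definition fills (p : nat) (A : seq nat) : bool :=
  sums_fill (N.of_nat p) (N.ones (N.of_nat p)) 1%num A.

Lemma covers_of_fills (p : nat) (A Q : seq nat) (e : rat) : prime p ->
  uniq A -> {subset A <= Q} -> recip A <= e -> fills p A -> covers p Q e.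
Proof.
move=> p_pr uA AQ Ae H r.
have X0 : sums_bits p 1%num [::].
  case=> [_|i]; last by case: i.
  by exists [::]; rewrite big_nil.
have := @sums_fillP p _ _ A [::] p_pr _ X0 H; rewrite cats0 => /(_ uA).
have rp : (val r < p)%N by have := ltn_ord r; rewrite [X in (_ < X)%N]Fp_cast.
case/(_ (N.of_nat (val r))).
  by rewrite N.ones_spec_low //; lia.
move=> S [uS SA Sr]; exists S; split=> //.
- by move=> x /SA/AQ.
- by rewrite Sr nat_of_binE Nnat.Nat2N.id natr_Zp.
- exact: le_trans (recip_subset uS SA) Ae.
Qed.

(** Rounding each [N / q] up turns a bound on a rational sum into a computation with natural
    numbers. *)
Lemma recip_scaled_bound (N : nat) (s : seq nat) : (0 < N)%N -> all (ltn 0) s ->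
  recip s <= (\sum_(q <- s) (N %/ q).+1)%:R / N%:R.
Proof.
move=> N0; elim: s => [|q s IH] /=; first by rewrite /recip !big_nil mul0r.
case/andP=> q0 /IH Hs; rewrite /recip !big_cons natrD mulrDl lerD //.
rewrite ler_pdivlMr ?ltr0n // mulrC ler_pdivrMr ?ltr0n // -natrM ler_nat.
exact: ltnW (ltn_ceil _ q0).
Qed.

(** * Sieved prime counts and growth in binary arithmetic *)

Definition small_primes : seq nat :=
  [:: 2; 3; 5; 7; 11; 13; 17; 19; 23; 29; 31; 37; 41; 43; 47; 53; 59; 61; 67; 71; 73; 79; 83; 89]%N.

Definition sieved (m : N) : bool :=
  all (fun q => ~~ N.eqb (N.modulo m (N.of_nat q)) 0) small_primes.

Lemma N_mod_eq0 (m q : nat) : (0 < q)%N ->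
  N.eqb (N.modulo (N.of_nat m) (N.of_nat q)) 0 = (q %| m)%N.
Proof.
move=> q0; have q0N : N.of_nat q <> 0%num by lia.
apply/idP/idP => [/N.eqb_spec/N.Div0.mod_divides|/dvdnP[c ->]].
  by case=> c E; apply/dvdnP; exists (nat_of_bin c); lia.
apply/N.eqb_spec; rewrite (_ : N.of_nat (c * q) = (N.of_nat c * N.of_nat q)%num); last by lia.
exact: N.Div0.mod_mul.
Qed.

(** A composite number below [91 ^ 2] has a prime factor below 91, and [small_primes] lists all of
    these. *)
Lemma prime_of_sieved (m : nat) : (1 < m < 91 ^ 2)%N -> sieved (N.of_nat m) -> prime m.
Proof.
case/andP=> m1 m91 /allP sm; apply: ltn_pdiv2_prime; first by lia.
apply: leq_trans m91 _; rewrite leq_exp2r // leqNgt; apply/negP => lt91.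
have : pdiv m \in small_primes.
  have : all (fun q => prime q ==> (q \in small_primes)) (iota 0 91) by vm_compute.
  move/allP/(_ (pdiv m)); rewrite mem_iota /= add0n => /(_ lt91)/implyP; apply.
  exact: pdiv_prime.
by move/sm; rewrite N_mod_eq0 ?pdiv_gt0 // pdiv_dvd.
Qed.

Fixpoint sieved_count (n : nat) (m : N) : nat :=
  if n is n'.+1 then (sieved m + sieved_count n' (N.succ m))%N else 0%N.
Arguments sieved : simpl never.

(** Only an inequality, since the sieve also strikes out the primes of [small_primes] themselves.
    Starting above 71 avoids all gadget primes. *)
Lemma sieved_count_le (n a : nat) : (71 < a)%N -> (a + n <= 91 ^ 2)%N ->
  (sieved_count n (N.of_nat a) <= count usable (iota a n))%N.
Proof.
elim: n a => // n IH a a71 an /=; have -> : N.succ (N.of_nat a) = N.of_nat a.+1 by lia.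
apply: leq_add; last by apply: IH; lia.
case sa : sieved => //; rewrite /usable (prime_of_sieved _ sa) ?lt0b; last by lia.
by rewrite /gadget_primes !inE; move: a71; do 4 (case: eqP => [->|_] //).
Qed.

Definition growthN (r x : N) : N :=
  (x + (N.div (x - 1) (2 * (N.div (2 * x) r + 1)) + 1))%num.

Lemma nat_of_bin_div (a b : N) : (0 < nat_of_bin b)%N ->
  nat_of_bin (N.div a b) = (nat_of_bin a %/ nat_of_bin b)%N.
Proof.
move=> b0; have b0N : b <> 0%num by lia.
move: (N.div_mod a b b0N) (N.mod_lt a b b0N).
move: (N.div a b) (N.modulo a b) => q r -> rb.
have -> : nat_of_bin (b * q + r) = (nat_of_bin q * nat_of_bin b + nat_of_bin r)%N by lia.
by rewrite divnMDl // divn_small ?addn0 //; lia.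
Qed.

Lemma growthNE (r x : N) : (0 < nat_of_bin r)%N ->
  nat_of_bin (growthN r x) = growth (nat_of_bin r) (nat_of_bin x).
Proof.
move=> r0; rewrite /growthN !nat_of_binD nat_of_bin_div; last by move: (N.div _ _) => q; lia.
have -> : nat_of_bin (2 * (2 * x / r + 1)) = (2 * (2 * nat_of_bin x %/ nat_of_bin r).+1)%N.
  have <- : nat_of_bin (2 * x)%num = (2 * nat_of_bin x)%N by lia.
  by rewrite -nat_of_bin_div //; move: (N.div _ _) => q; lia.
rewrite /growth addn1; congr (_ + (_ %/ _).+1)%N; lia.
Qed.

Lemma iter_growthNE (r : N) (k : nat) : (0 < nat_of_bin r)%N ->
  nat_of_bin (iter k (growthN r) 1%num) = iter k (growth (nat_of_bin r)) 1%N.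
Proof. by move=> r0; elim: k => //= k <-; rewrite growthNE. Qed.

Lemma nat_of_bin_pow2 (b : nat) : (2 ^ b)%N = nat_of_bin (2 ^ N.of_nat b)%num.
Proof.
elim: b => // b IH; rewrite expnS IH.
have -> : N.of_nat b.+1 = N.succ (N.of_nat b) by lia.
by rewrite N.pow_succ_r'; lia.
Qed.

Lemma growth_check (r : N) (k p b : nat) : (0 < nat_of_bin r)%N -> (p < 2 ^ b)%N ->
  N.leb (2 ^ N.of_nat b) (2 * iter k (growthN r) 1%num) ->
  (p < 2 * iter k (growth (nat_of_bin r)) 1)%N.
Proof.
move=> r0 pb; rewrite -iter_growthNE //; set g := iter _ _ _ => /N.leb_spec0 H.
apply: leq_trans pb _.
by rewrite nat_of_bin_pow2; lia.
Qed.

(** For the ranges of [p] in which Chebyshev's bound is too weak, the pool is counted by the sieve.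
    Comparing with [2 ^ b] instead of [p] lets one computation serve a whole range. *)
Lemma covers_sieved_pool (p P y r k b : nat) :
  prime p -> (P <= p < 2 ^ b)%N -> (71 < y <= P)%N -> (P <= 91 ^ 2)%N -> (0 < r)%N ->
  (12 * k <= 5 * y)%N -> (r + 2 * k <= sieved_count (P - y) (N.of_nat y))%N ->
  N.leb (2 ^ N.of_nat b) (2 * iter k (growthN (N.of_nat r)) 1%num) ->
  covers p (uprimes 5 p) (5 / 6).
Proof.
move=> p_pr /andP[Pp pb] /andP[y71 yP] P91 r0 ky rk gk.
have rE : nat_of_bin (N.of_nat r) = r by lia.
apply: (@covers_of_pool p P y r k) => //; first by lia.
  rewrite size_filter; apply: leq_trans rk _; apply: sieved_count_le; lia.
by rewrite -[r in growth r]rE; apply: growth_check gk; rewrite ?rE.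
Qed.

Lemma covers_pow2_pool (p j y r k : nat) :
  prime p -> (2 ^ j <= p < 2 ^ j.+1)%N -> (1 < j)%N -> (5 <= y)%N -> (0 < r)%N ->
  (12 * k <= 5 * y)%N -> N.leb (N.of_nat j * N.of_nat (r + 2 * k + y + 5)) (2 ^ N.of_nat j) ->
  N.leb (2 ^ N.of_nat j.+1) (2 * iter k (growthN (N.of_nat r)) 1%num) ->
  covers p (uprimes 5 p) (5 / 6).
Proof.
move=> p_pr /andP[jp pj] j1 y5 r0 ky rk gk.
have rE : nat_of_bin (N.of_nat r) = r by lia.
apply: (@covers_of_pool p (2 ^ j) y r k) => //; last first.
  by rewrite -[r in growth r]rE; apply: growth_check gk; rewrite ?rE.
have := size_uprimes_pow2 y j1; set z := size _ => Hz.
have j0 : (0 < j)%N by apply: ltnW.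
have : (j * (r + 2 * k + y + 5) <= j * (z + y + 5))%N.
  apply: leq_trans Hz; move/N.leb_spec0: rk; rewrite nat_of_bin_pow2.
  by move: (2 ^ _)%num => c; lia.
by rewrite leq_pmul2l //; lia.
Qed.

(* On each range of [p] the pair [(r, k)] minimises the number of primes needed,
   and [y] is the least integer with [12 * k <= 5 * y]. *)
Lemma covers_ge_2304 (p : nat) : prime p -> (2304 <= p)%N ->
  covers p (uprimes 5 p) (5 / 6).
Proof.
move=> p_pr lep.
have [p12|p12] := ltnP p (2 ^ 12).
  by apply: (@covers_sieved_pool p 2304 166 137 69 12 p_pr);
    [rewrite lep p12 | | | | | vm_cast_no_check (erefl true) ..].
have [p13|p13] := ltnP p (2 ^ 13).
  by apply: (@covers_sieved_pool p (2 ^ 12) 228 193 95 13 p_pr);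
    [rewrite p12 p13 | | | | | vm_cast_no_check (erefl true) ..].
have [p15|p15] := ltnP p (2 ^ 15).
  by apply: (@covers_sieved_pool p (2 ^ 13) 428 398 178 15 p_pr);
    [rewrite p13 p15 | | | | | vm_cast_no_check (erefl true) ..].
have [p16|p16] := ltnP p (2 ^ 16).
  by apply: (@covers_pow2_pool p 15 591 565 246 p_pr);
    [rewrite p15 p16 | | | | | vm_cast_no_check (erefl true) ..].
have [p17|p17] := ltnP p (2 ^ 17).
  by apply: (@covers_pow2_pool p 16 855 769 356 p_pr);
    [rewrite p16 p17 | | | | | vm_cast_no_check (erefl true) ..].
have [p18|p18] := ltnP p (2 ^ 18).
  by apply: (@covers_pow2_pool p 17 1186 1098 494 p_pr);
    [rewrite p17 p18 | | | | | vm_cast_no_check (erefl true) ..].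
exact: covers_ge_pow18.
Qed.

(* [if] rather than [&&] and [||], which [vm_compute] evaluates eagerly. *)
Definition fills_upto (lo n : nat) (A : seq nat) : bool :=
  all (fun p =>
    let pN := N.of_nat p in
    if has (fun q => if (q < p)%N then N.eqb (N.modulo pN (N.of_nat q)) 0 else false)
         small_primes
    then true else fills p [seq q <- A | (q < p)%N]) (iota lo n).

(** One list of primes serves a whole range of [p], truncated below [p]. Its reciprocals, rounded up
    to thousandths, total at most 833/1000, which is below 5/6. *)
Lemma covers_fills_upto (lo n a b p : nat) : (5 <= a)%N ->
  (sumn [seq (1000 %/ q).+1 | q <- uprimes a b] <= 833)%N ->
  fills_upto lo n (uprimes a b) -> prime p -> (lo <= p < lo + n)%N ->
  covers p (uprimes 5 p) (5 / 6).
Proof.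
move=> a5 H833 /allP H p_pr Hp.
have := H p (etrans (mem_iota _ _ _) Hp); cbv beta zeta.
case composite : (has _ small_primes).
  have /hasP[q qs] := composite.
  case: ifP => // qp + _.
  have q1 : (1 < q)%N.
    by have /allP/(_ q qs) : all (ltn 1) small_primes by [].
  rewrite N_mod_eq0; last by apply: ltnW.
  by case/primeP: p_pr => _ /[apply] /orP[] /eqP Eq; rewrite Eq ?ltnn in q1 qp.
apply: covers_of_fills => //; first by rewrite filter_uniq ?uprimes_uniq.
  move=> q; rewrite mem_filter !mem_uprimes => /andP[-> /and3P[-> aq _]].
  by rewrite (leq_trans a5 aq).
apply: le_trans (recip_subset _ (mem_subseq (filter_subseq _ _))) _.
  by rewrite filter_uniq ?uprimes_uniq.
apply: le_trans (recip_scaled_bound (N := 1000) isT _) _.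
  by apply/allP=> q; rewrite mem_uprimes => /and3P[_ aq _] /=; lia.
move: H833; rewrite sumnE big_map; move: (\sum_(_ <- _) _)%N => c.
by rewrite -(ler_nat rat) => c833; lra.
Qed.

Lemma covers_ge_23 (p : nat) : prime p -> (23 <= p)%N -> covers p (uprimes 5 p) (5 / 6).
Proof.
move=> p_pr lep.
have [p61|p61] := ltnP p 61.
  by apply: (@covers_fills_upto 23 38 5 61 p);
    [ | vm_cast_no_check (erefl true) .. | | rewrite lep].
have [p2304|] := ltnP p 2304; last exact: covers_ge_2304.
by apply: (@covers_fills_upto 61 2243 17 211 p);
  [ | vm_cast_no_check (erefl true) .. | | rewrite p61].
Qed.

(** * Divergence of the sum of reciprocals *)

Lemma uprimes_cat (a b c : nat) : (a <= b <= c)%N ->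
  uprimes a c = uprimes a b ++ uprimes b c.
Proof.
case/andP=> ab bc; rewrite -filter_cat /index_iota -{2}(subnKC ab) -iotaD.
by congr [seq _ <- iota _ _ | _]; lia.
Qed.

Lemma recip_cat (s t : seq nat) : recip (s ++ t) = recip s + recip t.
Proof. by rewrite /recip big_cat. Qed.

Lemma recip_cons (q : nat) (s : seq nat) : recip (q :: s) = q%:R^-1 + recip s.
Proof. by rewrite /recip big_cons. Qed.

Lemma recip_nil : recip [::] = 0.
Proof. by rewrite /recip big_nil. Qed.

Lemma uprimes1 (n : nat) : uprimes n n.+1 = if usable n then [:: n] else [::].
Proof. by rewrite /uprimes /index_iota subSnn /=. Qed.

Lemma uprimesS (a n : nat) : (a <= n)%N ->
  uprimes a n.+1 = uprimes a n ++ (if usable n then [:: n] else [::]).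
Proof. by move=> an; rewrite (@uprimes_cat a n n.+1) ?uprimes1 // an leqnSn. Qed.

(** Each dyadic block contributes at least 1/2. *)
Lemma harmonic_lb (k : nat) :
  (k%:R - 1) / 2 <= \sum_(2 <= j < 2 ^ k) j%:R^-1 :> rat.
Proof.
elim: k => [|[|k] IH]; [by rewrite big_geq | by rewrite big_geq |].
have k2 : (2 <= 2 ^ k.+1)%N by rewrite (@leq_pexp2l 2 1).
have kk : (2 ^ k.+1 <= 2 ^ k.+2)%N by rewrite leq_exp2l.
rewrite (big_cat_nat k2 kk) /= -[k.+2%:R]natr1.
suff : 2^-1 <= \sum_(2 ^ k.+1 <= j < 2 ^ k.+2) j%:R^-1 :> rat by move: IH; lra.
apply: le_trans (_ : \sum_(2 ^ k.+1 <= j < 2 ^ k.+2) ((2 ^ k.+2)%N%:R)^-1 <= _).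
  rewrite sumr_const_nat -[leRHS]mulr_natl.
  have -> : (2 ^ k.+2 - 2 ^ k.+1 = 2 ^ k.+1)%N by rewrite [in LHS]expnS; lia.
  rewrite [in X in _ * X]expnS natrM.
  have : (2 ^ k.+1)%N%:R != 0 :> rat by rewrite pnatr_eq0 -lt0n expn_gt0.
  move: ((2 ^ k.+1)%N%:R) => z z0.
  by rewrite le_eqVlt; apply/orP; left; apply/eqP; field.
rewrite big_nat_cond [leRHS]big_nat_cond; apply: ler_sum => j; rewrite andbT => /andP[j1 j2].
have j0 : (0 < j)%N by apply: leq_trans j1; rewrite expn_gt0.
by rewrite lef_pV2 ?posrE ?ltr0n ?expn_gt0 // ler_nat ltnW.
Qed.

(** Partial summation over dyadic blocks. The terms divided by [2 ^ J] are boundary terms that make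
    the induction close: passing to the next block gains half of [size / 2 ^ J], and Chebyshev's
    bound gives [size >= 2 ^ J / J - 5]. *)
Lemma recip_uprimes_pow2 (J : nat) : (2 <= J)%N ->
  2^-1 * \sum_(2 <= j < J) j%:R^-1 - 5 / 2 + 5 / (2 ^ J)%N%:R
    + (size (uprimes 0 (2 ^ J)))%:R / (2 ^ J)%N%:R <= recip (uprimes 0 (2 ^ J)).
Proof.
move=> /subnK <-; elim: (J - 2)%N => [|n].
  have -> : uprimes 0 (2 ^ (0 + 2)) = [:: 2; 3]%N by vm_compute.
  rewrite big_geq; last by [].
  rewrite /recip !big_cons big_nil [size _]/= (_ : (2 ^ (0 + 2) = 4)%N); last by [].
  lra.
rewrite addSn; move: (n + 2)%N (leq_addl n 2) => {}J J2 IH.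
have JJ : (2 ^ J <= 2 ^ J.+1)%N by rewrite leq_exp2l.
rewrite big_nat_recr //= (@uprimes_cat 0 (2 ^ J) (2 ^ J.+1)) ?JJ // recip_cat size_cat natrD.
set u := size _ in IH *; set s := recip _ in IH *; set v := size _.
have Hu : (2 ^ J <= J * (u + 5))%N.
  by have := @size_uprimes_pow2 0 J J2; rewrite addn0.
have Hv : v%:R / (2 ^ J.+1)%N%:R <= recip (uprimes (2 ^ J) (2 ^ J.+1)).
  rewrite /v -sum1_size natr_sum mulr_suml /recip big_seq [leRHS]big_seq.
  apply: ler_sum => q; rewrite mem_uprimes mul1r => /and3P[_ q1 q2].
  have q0 : (0 < q)%N by apply: leq_trans q1; rewrite expn_gt0.
  by rewrite lef_pV2 ?posrE ?ltr0n ?expn_gt0 // ler_nat ltnW.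
have z0 : (0 : rat) < (2 ^ J)%N%:R by rewrite ltr0n expn_gt0.
have J0 : (0 : rat) < J%:R by rewrite ltr0n; lia.
move: Hu Hv; rewrite -(ler_nat rat) natrM natrD [in (2 ^ J.+1)%N]expnS natrM.
move: IH z0; set z := (2 ^ J)%N%:R; move: (u%:R) (v%:R) => {}u {}v IH z0 Hu Hv.
have Hu' : J%:R^-1 <= u / z + 5 / z.
  by rewrite -mulrDl ler_pdivlMr // mulrC ler_pdivrMr // mulrC.
move: IH Hu' Hv; rewrite !invfM !mulrA; move: (z^-1) (J%:R^-1) => zi Ji.
move: (\sum_(_ <= _ < _) _) (recip _) => h g; lra.
Qed.

Lemma recip_uprimes_unbounded (B : nat) : exists n : nat, B%:R <= recip (uprimes 0 n).
Proof.
(* Chosen so that a quarter of [k - 1], minus the constant 5/2, is exactly [B]. *)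
pose k := (4 * B + 11)%N; pose J := (2 ^ k)%N.
exists (2 ^ J)%N.
have J2 : (2 <= J)%N by rewrite (@leq_pexp2l 2 1) // /k addnS.
apply: le_trans (recip_uprimes_pow2 J2).
have := harmonic_lb k; rewrite -/J; set h := \sum_(_ <= _ < _) _.
have A : (0 : rat) <= 5 / (2 ^ J)%N%:R by rewrite divr_ge0 ?ler0n.
have C : (0 : rat) <= (size (uprimes 0 (2 ^ J)))%:R / (2 ^ J)%N%:R by rewrite divr_ge0 ?ler0n.
have -> : k%:R = 4 * B%:R + 11 :> rat by rewrite /k natrD natrM.
move: (_ / _) A (_ / _) C => a A c C; lra.
Qed.

(** * Attained intervals *)

Definition modulus (n : nat) : nat := (\prod_(q <- uprimes 0 n) q)%N.

(** Only [usable] primes are bounded by [n], so the gadget primes may occur from the start without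
    clashing with a later step. *)
Definition allowed (n e : nat) : Prop :=
  product_of_two_distinct_primes e /\ forall p : nat, usable p -> (p %| e)%N -> (p < n)%N.

Definition attained (n : nat) (L U : rat) : Prop :=
  forall x : rat, x * (modulus n)%:R \is a Num.int -> L <= x <= U ->
  exists s : seq nat, [/\ uniq s, {in s, forall e, allowed n e} & recip s = x].

Lemma attained_sub (n : nat) (L U L' U' : rat) : L <= L' -> U' <= U ->
  attained n L U -> attained n L' U'.
Proof. by move=> LL UU H x /H{}H /andP[Lx xU]; apply: H; lra. Qed.

Lemma allowedS (n e : nat) : allowed n e -> allowed n.+1 e.
Proof. by case=> He H; split=> // p /H/[apply]; apply: leqW. Qed.

Lemma attained_skip (n : nat) (L U : rat) : ~~ usable n ->
  attained n L U -> attained n.+1 L U.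
Proof.
move=> nu H x; rewrite /modulus uprimesS // (negbTE nu) cats0 => /H{}H /H[s [us sn sx]].
by exists s; split=> // e /sn/allowedS.
Qed.

(** Write [x = a / (M * p)] with [M = modulus p]. Subtracting the terms [1 / (p * q)] leaves
    numerator [a - b], where [b] is the sum of [M / q]; [p] divides it as soon as the sum of the
    [1 / q] is [a / M] modulo [p]. *)
Lemma clear_prime (p : nat) (x : rat) : usable p -> x * (modulus p.+1)%:R \is a Num.int ->
  exists r : 'F_p, forall S : seq nat, {subset S <= uprimes 0 p} ->
    \sum_(q <- S) q%:R^-1 = r -> (x - recip S / p%:R) * (modulus p)%:R \is a Num.int.
Proof.
move=> up /intrP[a Ea]; have p_pr := usable_prime up; have p0 := prime_gt0 p_pr.
set M := modulus p.
have MS : modulus p.+1 = (M * p)%N.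
  by rewrite /M /modulus uprimesS // up big_cat /= big_seq1.
have small q : q \in uprimes 0 p -> (0 < q < p)%N.
  by rewrite mem_uprimes => /and3P[/usable_prime/prime_gt0 -> _ ->].
have Fp0 q : q \in uprimes 0 p -> q%:R != 0 :> 'F_p.
  move=> /small/andP[q0 qp]; rewrite Fp_nat_eq0 //.
  by apply/negP => /(dvdn_leq q0); rewrite leqNgt qp.
have MF : M%:R != 0 :> 'F_p.
  rewrite /M /modulus natr_prod big_seq prodf_seq_neq0.
  by apply/allP=> q /Fp0 ->; rewrite implybT.
exists (a%:~R / M%:R) => S SQ Sr.
have dvM q : q \in uprimes 0 p -> (q %| M)%N.
  by move=> qu; rewrite /M /modulus (perm_big _ (perm_to_rem qu)) big_cons dvdn_mulr.
pose b := (\sum_(q <- S) M %/ q)%N.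
have bQ : b%:R = recip S * M%:R :> rat.
  rewrite /b natr_sum /recip mulr_suml big_seq [RHS]big_seq; apply: eq_bigr => q /SQ qu.
  have q0 : q%:R != 0 :> rat by rewrite pnatr_eq0 -lt0n; case/andP: (small q qu).
  by apply: (mulIf q0); rewrite -natrM divnK ?dvM //; field.
have bF : b%:R = a%:~R :> 'F_p.
  transitivity ((\sum_(q <- S) q%:R^-1) * M%:R : 'F_p); last by rewrite Sr divfK.
  rewrite /b natr_sum mulr_suml big_seq [RHS]big_seq; apply: eq_bigr => q /SQ qu.
  by apply: (mulIf (Fp0 q qu)); rewrite -natrM divnK ?dvM // mulrAC mulVf ?mul1r ?Fp0.
have : (p %| a - b%:Z)%Z.
  by rewrite (dvdz_pcharf (pchar_Fp p_pr)) intrB -pmulrn bF subrr.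
case/dvdzP=> c /(congr1 (fun z : int => z%:~R : rat)); rewrite intrB intrM /= => Ec.
apply/intrP; exists c.
have p0Q : p%:R != 0 :> rat by rewrite pnatr_eq0 -lt0n.
apply: (mulIf p0Q); rewrite -[in RHS]/((p : int)%:~R) -Ec -Ea MS natrM.
have -> : (b%:Z)%:~R = recip S * M%:R :> rat by [].
by field.
Qed.

Lemma attained_step (p : nat) (L U e : rat) : usable p ->
  covers p (uprimes 0 p) e -> recip (uprimes 0 p) / p%:R <= U - L ->
  attained p L U ->
  attained p.+1 (L + e / p%:R) (U + recip (uprimes 0 p) / p%:R - e / p%:R).
Proof.
move=> up cov TUL H x xint /andP[Lx xU].
have p_pr := usable_prime up.
have p0 : 0 < p%:R :> rat by rewrite ltr0n prime_gt0.
set Q := uprimes 0 p in cov TUL xU *.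
have [r Hr] := clear_prime up xint.
suff [S [uS SQ Sr Sx]] : exists S, [/\ uniq S, {subset S <= Q},
    \sum_(q <- S) q%:R^-1 = r & L <= x - recip S / p%:R <= U].
  have [s [us sp sx]] := H _ (Hr S SQ Sr) Sx.
  have Sp q : q \in S -> prime q /\ (q < p)%N.
    by move=> /SQ; rewrite mem_uprimes => /and3P[/usable_prime].
  exists ([seq (p * q)%N | q <- S] ++ s); split.
  - rewrite cat_uniq us andbT map_inj_uniq ?uS /=; last first.
      by move=> q q' /eqP; rewrite eqn_pmul2l ?prime_gt0 // => /eqP.
    (* The new denominators are multiples of [p], whereas those from the previous stage have all
       their usable prime factors below [p]. *)
    apply/hasPn=> e' /sp[_ /(_ p up)] He; apply/mapP=> -[q _ Eq].
    by move: He; rewrite Eq dvdn_mulr // => /(_ isT); rewrite ltnn.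
  - move=> e'; rewrite mem_cat => /orP[/mapP[q /Sp[q_pr qp] ->]|/sp/allowedS//].
    split; first by exists p, q; rewrite p_pr q_pr neq_ltn qp orbT.
    move=> p' /usable_prime p'_pr; rewrite Euclid_dvdM // !dvdn_prime2 //.
    by case/orP=> /eqP->//; apply: ltnW.
  - rewrite recip_cat sx /recip big_map mulr_suml.
    under eq_bigr do rewrite natrM invfM mulrC.
    by rewrite addrCA subrr addr0.
(* When [x <= U] a light subset keeps the difference above [L]. Otherwise the complement of a light
   subset for the complementary residue brings [x] down to at most [U], and the width condition
   keeps it above [L]. *)
have [xleU|Ultx] := lerP x U.
  have [S [uS SQ Sr Se]] := cov r.
  exists S; split=> //; have := recip_ge0 S.
  have : recip S / p%:R <= e / p%:R by rewrite ler_pM2r ?invr_gt0.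
  move=> A /(divr_ge0)/(_ (ltW p0)); move: A Lx.
  by move: (e / _) (recip S / _) => ? ? *; apply/andP; split; lra.
have [S' [uS SQ Sr Se]] := cov (\sum_(q <- Q) q%:R^-1 - r).
pose S := [seq q <- Q | q \notin S'].
have split_sum (F : fieldType) : \sum_(q <- Q) q%:R^-1 =
    \sum_(q <- S') q%:R^-1 + \sum_(q <- S) q%:R^-1 :> F.
  rewrite -big_cat /=; apply: perm_big; apply: uniq_perm.
  - exact: uprimes_uniq.
  - rewrite cat_uniq uS filter_uniq ?uprimes_uniq // andbT.
    by apply/hasPn=> q; rewrite mem_filter => /andP[].
  - move=> q; rewrite mem_cat [q \in S]mem_filter.
    by case: (boolP (q \in S')) => [/SQ ->|_].
exists S; split.
- exact/filter_uniq/uprimes_uniq.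
- exact: mem_subseq (filter_subseq _ _).
- by move/eqP: Sr; rewrite split_sum eq_sym subr_eq => /eqP/addrI.
have RS : recip Q = recip S' + recip S := split_sum rat.
have : recip S' / p%:R <= e / p%:R by rewrite ler_pM2r ?invr_gt0.
have := divr_ge0 (recip_ge0 S') (ltW p0).
move: xU TUL Ultx; rewrite RS mulrDl.
by move: (e / _) (recip S / _) (recip S' / _) => ? ? ? *; apply/andP; split; lra.
Qed.

(** * The initial intervals *)

Definition base_gadgets : seq (nat * seq nat) :=
  [:: (35, [:: 6]); (21, [:: 10]); (15, [:: 14]); (14, [:: 15]); (10, [:: 21]);
      (6, [:: 35]); (7, [:: 62; 93; 155]); (5, [:: 82; 123; 287]);
      (3, [:: 118; 295; 413]); (2, [:: 213; 355; 497])]%N.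

Fixpoint bitseqs (n : nat) : seq bitseq :=
  if n is n'.+1 then map (cons false) (bitseqs n') ++ map (cons true) (bitseqs n')
  else [:: [::]].

Definition allowedb (n e : nat) : bool :=
  let p := pdiv e in let q := (e %/ p)%N in
  [&& prime p, prime q, p != q, (e == p * q)%N
    & all (fun p' => usable p' ==> (p' < n)%N) (primes e)].

Lemma allowedP (n e : nat) : allowedb n e -> allowed n e.
Proof.
case/and5P=> p_pr q_pr pq /eqP eE /allP H; split; first by exists (pdiv e), (e %/ pdiv e)%N.
move=> p up pe; have p_pr' := usable_prime up.
have e0 : (0 < e)%N by rewrite eE muln_gt0 !prime_gt0.
by have /H/implyP/(_ up) : p \in primes e by rewrite mem_primes p_pr' e0.
Qed.

Lemma mask_map_flatten_subseq (T : eqType) (m : bitseq) (ss : seq (seq T)) :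
  subseq (flatten (mask m ss)) (flatten ss).
Proof.
elim: ss m => [|s ss IH] [|[] m] //=; first exact: sub0seq.
  by rewrite cat_subseq.
exact: subseq_trans (IH m) (suffix_subseq _ _).
Qed.

(** For a triple [a, b, c] from 2, 3, 5, 7 the number [P = ab + bc + ca] is one of the primes 31,
    41, 59, 71, and [1/(aP) + 1/(bP) + 1/(cP) = 1/(abc)], which has denominator dividing 210. *)
Lemma recip_gadget (g : nat * seq nat) : g \in base_gadgets ->
  recip g.2 = g.1%:R / 210.
Proof.
rewrite /base_gadgets.
by do 10 (case/predU1P=> [->|]; first by rewrite /recip !big_cons big_nil /=; lra).
Qed.

Lemma recip_gadgets (m : bitseq) :
  recip (flatten (mask m (unzip2 base_gadgets))) =
  (sumn (mask m (unzip1 base_gadgets)))%:R / 210.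
Proof.
elim: base_gadgets (@recip_gadget) m => [|g G IH] HG [|b m] /=;
  try by rewrite /recip big_nil mul0r.
have {}IH := IH (fun h hG => HG h (mem_behead (s := g :: G) hG)) m.
by case: b => //=; rewrite recip_cat IH natrD mulrDl HG ?mem_head.
Qed.

(** The ten numerators total 118. All of 5 to 113 are subset sums, while 4 and its complementary
    value 114 are not. *)
Lemma attained_base : attained 11 (5 / 210) (113 / 210).
Proof.
move=> x; have -> : modulus 11 = 210%N.
  rewrite /modulus (_ : uprimes 0 11 = [:: 2; 3; 5; 7]%N); last by vm_compute.
  by rewrite !big_cons big_nil.
case/intrP=> a Ea /andP[La aU].
have a0 : 0 <= a.
  by rewrite -(ler_int rat) -Ea; lra.
pose n := `|a|%N.
move: Ea; rewrite -(gez0_abs a0) -/n => Ea.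
have xE : x = n%:R / 210 by move: Ea; rewrite -pmulrn; lra.
have Hn : (5 <= n < 114)%N.
  move: La aU; rewrite xE => La aU.
  have : 5%:R <= n%:R :> rat by lra.
  have : n%:R <= 113%:R :> rat by lra.
  by rewrite !ler_nat => *; apply/andP; split.
have : all (fun n => has (fun m => sumn (mask m (unzip1 base_gadgets)) == n) (bitseqs 10))
    (iota 5 109) by vm_cast_no_check (erefl true).
move/allP/(_ n (etrans (mem_iota _ _ _) Hn))/hasP=> [m _ /eqP mn].
exists (flatten (mask m (unzip2 base_gadgets))); split.
- apply: subseq_uniq (mask_map_flatten_subseq _ _) _; by vm_compute.
- move=> e /(mem_subseq (mask_map_flatten_subseq _ _)) => He; apply: allowedP.
  have H : all (allowedb 11) (flatten (unzip2 base_gadgets)) by vm_cast_no_check (erefl true).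
  exact: allP H e He.
by rewrite recip_gadgets mn xE.
Qed.

Lemma attained_step_fills (p : nat) (Q A : seq nat) (L U L' U' : rat) :
  uprimes 0 p = Q -> [&& usable p, uniq A, all [in Q] A & fills p A] ->
  recip Q / p%:R <= U - L -> L + recip A / p%:R <= L' ->
  U' <= U + recip Q / p%:R - recip A / p%:R ->
  attained p L U -> attained p.+1 L' U'.
Proof.
move=> <- /and4P[up uA /allP AQ fA] TUL LL UU H; apply: attained_sub LL UU _.
apply: attained_step => //.
exact: covers_of_fills (usable_prime up) uA AQ (lexx _) fA.
Qed.

(** Steps at 11, 13, 17 and 19 with endpoints rounded inwards. At 11 and 13 all smaller primes serve
    as [A], so the upper end gains nothing; from 17 on the prime 2 is left out and the upper end
    rises. The final width 77/300 exceeds 1/4. *)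
Lemma attained23 : attained 23 (1 / 3) (59 / 100).
Proof.
have H12 : attained 12 (1310 / 10000) (5380 / 10000).
  apply: (attained_step_fills (Q := [:: 2; 3; 5; 7]%N) (A := [:: 2; 3; 5; 7]%N)) attained_base;
    [by vm_compute | by vm_compute | rewrite !recip_cons recip_nil; lra..].
have H14 : attained 14 (2285 / 10000) (5380 / 10000).
  apply: (attained_step_fills (Q := [:: 2; 3; 5; 7; 11]%N) (A := [:: 2; 3; 5; 7; 11]%N))
    (attained_skip _ H12);
    [by vm_compute | by vm_compute | rewrite !recip_cons recip_nil; lra.. | by vm_compute].
have H18 : attained 18 (2782 / 10000) (5674 / 10000).
  apply: (attained_step_fills (Q := [:: 2; 3; 5; 7; 11; 13]%N) (A := [:: 3; 5; 7; 11; 13]%N))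
    (attained_skip _ (attained_skip _ (attained_skip _ H14)));
    [by vm_compute | by vm_compute | rewrite !recip_cons recip_nil; lra.. | | | ]; by vm_compute.
have H20 : attained 20 (1 / 3) (59 / 100).
  apply: (attained_step_fills (Q := [:: 2; 3; 5; 7; 11; 13; 17]%N)
    (A := [:: 3; 5; 7; 11; 13; 17]%N)) (attained_skip _ H18);
    [by vm_compute | by vm_compute | rewrite !recip_cons recip_nil; lra.. | by vm_compute].
by do 3 (apply: attained_skip; first by vm_compute).
Qed.

(** * Drift of the attained intervals and conclusion *)

Definition half_mass (p : nat) : rat := recip (uprimes 0 p) / p%:R / 2.

Definition drift (n : nat) : rat := \sum_(p <- uprimes 23 n) half_mass p.

Lemma driftS (n : nat) : (23 <= n)%N ->
  drift n.+1 = drift n + (if usable n then half_mass n else 0).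
Proof.
move=> n23; rewrite /drift uprimesS // big_cat /=; congr (_ + _).
by case: ifP => _; rewrite ?big_seq1 ?big_nil.
Qed.

Lemma recip_uprimes_le (n : nat) : (23 <= n)%N -> recip (uprimes 0 n) <= n%:R / 4.
Proof.
move=> /subnK <-; elim: (n - 23)%N => [|k IH].
  rewrite (_ : uprimes 0 (0 + 23) = [:: 2; 3; 5; 7; 11; 13; 17; 19]%N); last by vm_compute.
  by rewrite add0n !recip_cons recip_nil; lra.
rewrite addSn uprimesS // recip_cat -natr1 mulrDl lerD //.
have k4 : (4 <= k + 23)%N by rewrite addnC.
case: ifP => _; rewrite ?recip_cons recip_nil ?addr0; last by lra.
by rewrite div1r lef_pV2 ?posrE ?ltr0n ?(leq_trans _ k4) // (ler_nat _ 4).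
Qed.

(** Keeps the full mass [2 * half_mass p] at most 1/4, below the constant width 59/100 - 1/3 of the
    drifting intervals. *)
Lemma half_mass_le (p : nat) : (23 <= p)%N -> half_mass p <= 1 / 8.
Proof.
move=> p23; have p0 : 0 < p%:R :> rat by rewrite ltr0n (leq_trans _ p23).
have : recip (uprimes 0 p) / p%:R <= 1 / 4.
  by rewrite ler_pdivrMr // (le_trans (recip_uprimes_le p23)) //; lra.
rewrite /half_mass; lra.
Qed.

(** The chosen set avoids 2 and 3, so [recip S + 5/6] is at most the total; as [recip S] is itself
    at most 5/6, it is at most half of the total. *)
Lemma covers_half (p : nat) : usable p -> (23 <= p)%N ->
  covers p (uprimes 0 p) (recip (uprimes 0 p) / 2).
Proof.
move=> up p23 r; have [S [uS SQ Sr Se]] := covers_ge_23 (usable_prime up) p23 r.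
have SQ' q : q \in [:: 2, 3 & S]%N -> q \in uprimes 0 p.
  rewrite !inE => /or3P[/eqP->|/eqP->|/SQ]; rewrite !mem_uprimes; last first.
  - by case/and3P=> -> _ ->.
  - by rewrite (leq_trans _ p23).
  - by rewrite (leq_trans _ p23).
have u23 : uniq [:: 2, 3 & S]%N.
  by rewrite /= uS inE /= andbT; apply/andP; split; apply/negP => /SQ; rewrite mem_uprimes.
exists S; split=> //; first by move=> q qS; apply: SQ'; rewrite !inE qS !orbT.
have := recip_subset u23 SQ'; rewrite !recip_cons => H.
rewrite ler_pdivlMr //; lra.
Qed.

Lemma attained_drift (n : nat) : (23 <= n)%N ->
  attained n (1 / 3 + drift n) (59 / 100 + drift n).
Proof.
move=> /subnK <-; elim: (n - 23)%N => [|k IH].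
  rewrite add0n (_ : drift 23 = 0) ?addr0; first exact: attained23.
  by rewrite /drift /uprimes /index_iota subnn big_nil.
have k23 : (23 <= k + 23)%N by rewrite leq_addl.
rewrite addSn driftS //; move: (k + 23)%N k23 IH => {k} {}n n23 IH.
case: ifPn => un; last by rewrite !addr0; apply: attained_skip.
have := half_mass_le n23; rewrite /half_mass => T4.
apply: attained_sub (attained_step un (covers_half un n23) _ IH).
- by rewrite mulrAC addrA.
- by rewrite [_ / 2 / _]mulrAC; lra.
- by move: T4; lra.
Qed.

(** The prime 2 alone gives [half_mass p >= 1 / (4 * p)], so the drift dominates a quarter of a
    divergent sum. The 8 in [4 * m + 8] absorbs the primes below 23, whose reciprocals sum to at
    most 23/4. *)
Lemma drift_unbounded (m : nat) : exists2 n, (23 <= n)%N & m%:R <= drift n.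
Proof.
have [n Hn] := recip_uprimes_unbounded (4 * m + 8).
have R23 : recip (uprimes 0 23) <= 23 / 4 := recip_uprimes_le (leqnn 23).
have n23 : (23 <= n)%N.
  rewrite leqNgt; apply/negP => n23; move: Hn; rewrite leNgt => /negP; apply.
  apply: le_lt_trans (_ : recip (uprimes 0 23) < _).
    rewrite (@uprimes_cat 0 n 23) ?(ltnW n23) // recip_cat.
    by rewrite lerDl recip_ge0.
  by apply: le_lt_trans R23 _; rewrite natrD natrM; have := ler0n rat m; lra.
exists n => //.
move: Hn; rewrite (@uprimes_cat 0 23 n) ?n23 // recip_cat natrD natrM.
suff : recip (uprimes 23 n) / 4 <= drift n by lra.
rewrite /recip /drift mulr_suml big_seq [leRHS]big_seq; apply: ler_sum => p.
rewrite mem_uprimes => /and3P[up p23 _].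
have p0 : 0 < p%:R :> rat by rewrite ltr0n (leq_trans _ p23).
have : 2^-1 <= recip (uprimes 0 p).
  have := @recip_subset [:: 2]%N (uprimes 0 p) isT; rewrite recip_cons recip_nil addr0; apply.
  by move=> q; rewrite inE => /eqP->; rewrite mem_uprimes (leq_trans _ p23).
rewrite /half_mass -invr_gt0 in p0 *; move: (p%:R^-1) p0 (recip _) => z z0 g g2.
have := ler_wpM2r (ltW z0) g2; lra.
Qed.

Theorem theorem1p2 (m : nat) (hm : (1 <= m)%N) :
  exists s : seq nat,
    [/\ sorted ltn s,
        forall n : nat, n \in s -> product_of_two_distinct_primes n
      & m%:R = \sum_(n <- s) n%:R^-1 :> rat].
Proof.
have [N N23 HN] := drift_unbounded m.
have m1 : 1 <= m%:R :> rat by rewrite (ler_nat _ 1).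
(* The lower end starts at 1/3, below [m]. Each shift is at most 1/8, less than the width, so
   consecutive intervals overlap and [m] cannot be jumped over. *)
have [n n23 Hn] : exists2 n, (23 <= n)%N & 1 / 3 + drift n <= m%:R <= 59 / 100 + drift n.
  have {HN} : m%:R <= 59 / 100 + drift N by lra.
  rewrite -(subnK N23); elim: (N - 23)%N => [|k IH].
    by rewrite add0n /drift /uprimes /index_iota subnn big_nil; lra.
  have k23 : (23 <= k + 23)%N by rewrite leq_addl.
  have [/IH//|ltk] := lerP m%:R (59 / 100 + drift (k + 23)).
  rewrite addSn => Hk; exists (k + 23).+1; first exact: leqW.
  rewrite Hk andbT (driftS k23); have := half_mass_le k23.
  by move: ltk; case: ifP => _; lra.
have [|s [us sn sx]] := attained_drift n23 (x := m%:R) _ Hn.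
  by rewrite -natrM; apply/intrP; exists (m * modulus n)%N.
exists (sort leq s); split.
- by rewrite ltn_sorted_uniq_leq sort_uniq us sort_sorted //; apply: leq_total.
- by move=> e; rewrite mem_sort => /sn[].
- by rewrite -sx /recip; apply: perm_big; rewrite perm_sym perm_sort.
Qed.
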